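(* Let $L\ge3$ and let $\hat\rho$ be a density operator on $\mathcal H_A\otimes\mathcal H_B$ with $\hat P^{(1)}\hat\rho\hat P^{(1)}=\hat\rho$. Define $e^{(\mathrm b,1)}=\mathrm{tr}(\hat\rho\,\hat e^{(\mathrm b)})$ and $e^{(\mathrm{ph},1)}=\mathrm{tr}(\hat\rho\,\hat e^{(\mathrm{ph})})$. If $0\le e^{(\mathrm b,1)}\le(10-3\sqrt5)/22$, then $$e^{(\mathrm{ph},1)}\le(3+\sqrt5)\,e^{(\mathrm b,1)},$$ and if $e^{(\mathrm b,1)}>(10-3\sqrt5)/22$, then $$e^{(\mathrm{ph},1)}\le\inf_{0<\lambda<3+\sqrt5}\Big\{\lambda e^{(\mathrm b,1)}+\frac{3-2\lambda+\sqrt{1+2\lambda^2}}{4}\Big\}.$$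
   Context: $\mathcal H_A=(\mathbb C^2)^{\otimes L}$ (qubits labelled $1,\dots,L$, with $Z$-basis $|0\rangle,|1\rangle$) and $\mathcal H_B=\mathbb C^L$ with orthonormal basis $|1\rangle_B,\dots,|L\rangle_B$. $\hat P(|\psi\rangle)=|\psi\rangle\langle\psi|$, $\bar s=s\oplus1$, and $\hat H|s\rangle=(|0\rangle+(-1)^s|1\rangle)/\sqrt2$. Let $\kappa_1=\kappa_L=1$ and $\kappa_i=1/2$ for $2\le i\le L-1$. For $1\le j\le L-1$ and $s\in\{0,1\}$ let $\hat\Pi_{j,s}=\hat P\big((\sqrt{\kappa_j}|j\rangle_B+(-1)^s\sqrt{\kappa_{j+1}}|j+1\rangle_B)/\sqrt2\big)$. Define (operators on the indicated qubits tensored with identity on the remaining qubits) $$\hat e^{(\mathrm{ph})}_j=\hat P(|1\rangle_{A,j}|1\rangle_{A,j+1})\otimes\sum_{s=0}^1\kappa_{j+s}\hat P(|j+s\rangle_B)+\sum_{s=0}^1\hat P(|s\rangle_{A,j}|\bar s\rangle_{A,j+1})\otimes\kappa_{j+s}\hat P(|j+s\rangle_B),$$ $$\hat e^{(\mathrm b)}_j=\sum_{s,s'\in\{0,1\}}\hat P(\hat H|s\rangle_{A,j})\otimes\hat P(\hat H|s'\rangle_{A,j+1})\otimes\hat\Pi_{j,s\oplus s'\oplus1},$$ and $\hat e^{(\mathrm{ph})}=\sum_{j=1}^{L-1}\hat e^{(\mathrm{ph})}_j$, $\hat e^{(\mathrm b)}=\sum_{j=1}^{L-1}\hat e^{(\mathrm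 b)}_j$. For $\bm a\in\{0,1\}^L$ let $|\bm a\rangle_A=|a_1\rangle_{A,1}\cdots|a_L\rangle_{A,L}$ and $\mathrm{wt}(\bm a)$ the number of $1$'s. The projector for one-photon emission is $\hat P^{(1)}=\sum_{\bm a:\,\mathrm{wt}(\bm a)=1}\sum_{i=1}^L\hat P(|\bm a\rangle_A|i\rangle_B)$. (Physically, $e^{(\mathrm b,1)}$ and $e^{(\mathrm{ph},1)}$ are the bit and phase error rates of single-photon emission events in the DPS QKD protocol.) *)

(* Defs.v *)
From HB Require Import structures.
From mathcomp Require Import all_boot all_order all_algebra.
From mathcomp Require Import complex.
From mathcomp Require Import boolp classical_sets reals.
Set Implicit Arguments. Unset Strict Implicit. Unset Printing Implicit Defensive.
Import Order.TTheory GRing.Theory Num.Theory.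
Local Open Scope ring_scope.

(* Conventions: qubits and modes of B are labelled 0,...,L-1 (paper: 1,...,L);
   the pairs (j, j+1) of the paper, j = 1..L-1, become j = 0..L-2. *)

Section DPS.
Variable R : realType.
Local Notation C := R[i].
Variable L : nat.

(* basis of H_A (x) H_B : |a>_A |i>_B with a in {0,1}^L, i a mode of B *)
Definition idx := (L.-tuple bool * 'I_L)%type.
Definition dimH := #|{: idx}|.
Definition op := 'M[C]_dimH.

Definition mx_of (f : idx -> idx -> C) : op :=
  \matrix_(i, j) f (enum_val i) (enum_val j).

Definition kappa (m : nat) : R :=
  if (m == 0)%N || (m == L.-1)%N then 1 else 1 / 2.

Definition sqrtC' (x : R) : C := ((Num.sqrt x)%:C)%C.

Definition proj (T : Type) (v : T -> C) : T -> T -> C :=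
  fun x y => v x * (v y)^*.

(* single-qubit Z-basis kets and Hadamard-rotated kets H|s> *)
Definition qket (s : bool) : bool -> C := fun x => (x == s)%:R.
Definition hket (s : bool) : bool -> C :=
  fun x => (if x then (-1) ^+ s else 1) / sqrtC' 2.
Definition pair2 (u v : bool -> C) : bool * bool -> C :=
  fun p => u p.1 * v p.2.

Definition bket (m : nat) : 'I_L -> C := fun i => (i == m :> nat)%:R.
Definition piket (j : nat) (s : bool) : 'I_L -> C :=
  fun i => (sqrtC' (kappa j) * bket j i
            + (-1) ^+ s * sqrtC' (kappa j.+1) * bket j.+1 i) / sqrtC' 2.

(* Q acting on qubits j, j+1 (matrix elements Q (x_j,x_{j+1}) (y_j,y_{j+1})),
   identity on the other qubits, tensored with M acting on H_B *)
Definition emb2 (j : nat) (Q : bool * bool -> bool * bool -> C)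
    (M : 'I_L -> 'I_L -> C) : op :=
  mx_of (fun x y =>
    [forall k : 'I_L, ((k != j :> nat) && (k != j.+1 :> nat)) ==>
                       (tnth x.1 k == tnth y.1 k)]%:R
    * Q (nth false x.1 j, nth false x.1 j.+1) (nth false y.1 j, nth false y.1 j.+1)
    * M x.2 y.2).

Definition e_ph_j (j : nat) : op :=
  emb2 j (proj (pair2 (qket true) (qket true)))
         (fun i i' => \sum_(s : bool) ((kappa (j + s))%:C)%C * proj (bket (j + s)) i i')
  + \sum_(s : bool) emb2 j (proj (pair2 (qket s) (qket (~~ s))))
         (fun i i' => ((kappa (j + s))%:C)%C * proj (bket (j + s)) i i').

Definition e_b_j (j : nat) : op :=
  \sum_(s : bool) \sum_(s' : bool)
     emb2 j (proj (pair2 (hket s) (hket s'))) (proj (piket j (s (+) s' (+) true))).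

Definition e_ph : op := \sum_(j < L.-1) e_ph_j j.
Definition e_b : op := \sum_(j < L.-1) e_b_j j.

(* projector onto one-photon emission: wt(a) = 1 *)
Definition P1 : op :=
  mx_of (fun x y => ((x == y) && (count id x.1 == 1)%N)%:R).

Definition adj (m n : nat) (A : 'M[C]_(m, n)) : 'M[C]_(n, m) := (map_mx (@Num.conj _) A)^T.

Definition density (rho : op) : Prop :=
  [/\ adj rho = rho,
      (forall v : 'cV[C]_dimH, 0 <= ((adj v) *m rho *m v) 0 0)
    & \tr rho = 1].

End DPS.

(* Main.v *)
(** On the one-photon sector, with basis |k,i> (k the position of the photon, i
    the mode of B), e_ph is diagonal and supported on |k - i| = 1, and
    e_b = (1 - A) / 2 where A couples |j,j> with |j+1,j+1> and |j,j+1> with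
    |j+1,j>, both with amplitude sqrt (kappa_j kappa_(j+1)).  So e_ph - l e_b
    splits into the diagonal chain, where it is nonpositive, into 2 x 2 blocks,
    whose largest eigenvalue (3 - 2 l + sqrt (1 + 2 l^2)) / 4 is attained on the
    two boundary blocks, and into the scalar -l/2.  That eigenvalue is
    nonnegative for 0 < l <= 3 + sqrt 5 and vanishes at the right end point. *)

Require Import Defs.
From HB Require Import structures.
From mathcomp Require Import all_boot all_order all_algebra.
From mathcomp Require Import complex.
From mathcomp Require Import boolp classical_sets reals.
From mathcomp Require Import ring lra.
Import Order.TTheory GRing.Theory Num.Theory.
Local Open Scope ring_scope.
Local Open Scope classical_set_scope.

Local Notation Re := (@complex.Re _).

(** * Quadratic forms and matrix entries indexed by basis kets *)

Lemma mulmx_delta2 (F : comNzRingType) N (A : 'M[F]_N) (i j : 'I_N) (a b : F) :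
  ((a *: delta_mx 0 i + b *: delta_mx 0 j) *m A
   *m (a *: delta_mx i 0 + b *: delta_mx j 0) : 'M_1) 0 0
  = a * (a * A i i) + a * (b * A i j) + (b * (a * A j i) + b * (b * A j j)).
Proof.
rewrite !mulmxDl !mulmxDr -!scalemxAl -!scalemxAr -!rowE -!colE !mxE.
ring.
Qed.

Section Entries.
Variable R : realType.
Local Notation C := R[i].

Lemma ReD (x y : C) : Re (x + y) = Re x + Re y.
Proof. by case: x y => [a b] [c d]. Qed.

Lemma Re_sum (I : finType) (F : I -> C) : Re (\sum_i F i) = \sum_i Re (F i).
Proof. by apply: (big_morph _ ReD). Qed.

Lemma Re_mulr_real (z : C) (a : R) : Re (z * (a%:C)%C) = Re z * a.
Proof. by case: z => x y /=; rewrite mulr0 subr0. Qed.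

Lemma conj_real (a : R) : ((a%:C)%C : C)^* = (a%:C)%C.
Proof. exact: conjc_real. Qed.

Lemma Re_conj (z : C) : Re z^* = Re z.
Proof. by case: z. Qed.

(** Positivity is tested on a real vector supported on two basis vectors. Hermiticity gives the two
    cross terms the same real part, so they merge into one. *)
Lemma psd_form N (A : 'M[C]_N) (i j : 'I_N) (a b : R) : adj A = A ->
  (forall v : 'cV[C]_N, 0 <= ((adj v) *m A *m v) 0 0) ->
  0 <= a ^+ 2 * Re (A i i) + 2 * a * b * Re (A i j) + b ^+ 2 * Re (A j j).
Proof.
move=> herm pos.
have Aji : Re (A j i) = Re (A i j) by rewrite -[in LHS]herm !mxE Re_conj.
have := pos ((a%:C)%C *: delta_mx i 0 + (b%:C)%C *: delta_mx j 0).
set v := _ + _.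
have -> : adj v = (a%:C)%C *: delta_mx 0 i + (b%:C)%C *: delta_mx 0 j.
  apply/matrixP => k l.
  rewrite !mxE -!(rmorph_nat (real_complex R)) -!rmorphM -!rmorphD.
  by rewrite conj_real; congr (_%:C)%C; rewrite !(andbC (k == 0)).
rewrite mulmx_delta2 lecE => /andP[_].
rewrite !mulrA !ReD -!rmorphM ![((_%:C)%C : C) * _]mulrC !Re_mulr_real Aji.
congr (_ <= _); ring.
Qed.

Variable L : nat.
Implicit Types (x y : idx L) (A B rho : op R L).

Definition entry A x y : C := A (enum_rank x) (enum_rank y).

Lemma entryD A B x y : entry (A + B) x y = entry A x y + entry B x y.
Proof. by rewrite /entry mxE. Qed.

Lemma entry_sum (I : finType) (F : I -> op R L) x y :
  entry (\sum_i F i) x y = \sum_i entry (F i) x y.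
Proof. by rewrite /entry summxE. Qed.

Lemma entry_mx_of f x y : entry (mx_of f) x y = f x y.
Proof. by rewrite /entry mxE !enum_rankK. Qed.

Lemma sum_enum_rank (F : 'I_(dimH L) -> C) :
  \sum_i F i = \sum_x F (enum_rank x).
Proof.
rewrite (reindex (@enum_rank (idx L))) //.
by exists enum_val => i _; [exact: enum_rankK | exact: enum_valK].
Qed.

Lemma entryM A B x y : entry (A *m B) x y = \sum_z entry A x z * entry B z y.
Proof. by rewrite /entry mxE sum_enum_rank. Qed.

Lemma trace_entry A : \tr A = \sum_x entry A x x.
Proof. by rewrite /mxtrace sum_enum_rank. Qed.

Lemma entry_P1 x y :
  entry (P1 R L) x y = ((x == y) && (count id x.1 == 1)%N)%:R.
Proof. exact: entry_mx_of. Qed.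

(** [P1] is diagonal with 0/1 entries, so the sandwich multiplies each entry of [rho] by the two
    weight-one indicators. *)
Lemma one_photon_support rho x y : P1 R L *m rho *m P1 R L = rho ->
  ~~ ((count id x.1 == 1)%N && (count id y.1 == 1)%N) -> entry rho x y = 0.
Proof.
move=> <-; rewrite entryM negb_and => xy.
apply: big1 => z _; rewrite entryM entry_P1.
have [->|zy] := eqVneq z y; last by rewrite mulr0.
case/orP: xy => [/negbTE x1|/negbTE->]; last by rewrite mulr0.
by rewrite big1 ?mul0r // => t _; rewrite entry_P1 x1 andbF mul0r.
Qed.

Lemma density_form rho x y (a b : R) : density rho ->
  0 <= a ^+ 2 * Re (entry rho x x) + 2 * a * b * Re (entry rho x y)
       + b ^+ 2 * Re (entry rho y y).
Proof. by case=> herm pos _; exact: psd_form. Qed.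

End Entries.

(** * Bit strings of weight one *)

Section OnePhoton.
Variable L : nat.

Definition one_photon (k : 'I_L) : L.-tuple bool := [tuple m == k | m < L].

Lemma nth_one_photon (k : 'I_L) (m : nat) :
  nth false (one_photon k) m = (m == k :> nat).
Proof.
have [lt_mL|le_Lm] := ltnP m L.
  by rewrite -[m]/(nat_of_ord (Ordinal lt_mL)) -tnth_nth tnth_mktuple.
rewrite nth_default ?size_tuple //; apply/esym/negbTE.
by rewrite neq_ltn (leq_trans (ltn_ord k) le_Lm) orbT.
Qed.

Lemma one_photon_inj : injective one_photon.
Proof.
move=> k l /(congr1 (fun t => tnth t k)).
by rewrite !tnth_mktuple eqxx => /esym/eqP.
Qed.

Lemma count_tuple (a : L.-tuple bool) : count id a = (\sum_m tnth a m)%N.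
Proof. by rewrite -sum1_count big_mkcond big_tuple; apply: eq_bigr => m _ /=; case: (tnth a m). Qed.

Lemma count_one_photon k : count id (one_photon k) = 1%N.
Proof.
rewrite count_tuple (bigD1 k) //= big1 ?tnth_mktuple ?eqxx // => m /negbTE mk.
by rewrite tnth_mktuple mk.
Qed.

Lemma count1_one_photon (a : L.-tuple bool) :
  count id a = 1%N -> exists k, a = one_photon k.
Proof.
rewrite count_tuple => a1.
have [k ak] : exists k, tnth a k.
  apply/existsP; apply: contra_eqT a1 => /existsPn na.
  by rewrite big1 // => m _; apply/eqP; rewrite eqb0 na.
exists k; apply: eq_from_tnth => m; rewrite tnth_mktuple.
have [->//|mk] := eqVneq m k; move: a1.
by rewrite (bigD1 k) //= ak (bigD1 m) //=; case: (tnth a m).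
Qed.

Lemma sum_one_photon (V : zmodType) (F : idx L -> V) :
  (forall x : idx L, (count id x.1 != 1)%N -> F x = 0) ->
  \sum_x F x = \sum_k \sum_i F (one_photon k, i).
Proof.
move=> F0; rewrite pair_big /=.
rewrite (bigID (fun x : idx L => x.1 \in codom one_photon)) /=.
rewrite [X in _ + X]big1 ?addr0; last first.
  move=> x xN; apply: F0; apply: contra xN => /eqP/count1_one_photon[k ->].
  exact: codom_f.
(* The default [x.2] merely inhabits ['I_L]: on the codomain of [one_photon] the pick always
   succeeds. *)
rewrite (reindex_onto (fun p : 'I_L * 'I_L => (one_photon p.1, p.2))
  (fun x => (odflt x.2 [pick k | one_photon k == x.1], x.2))) /=; last first.
  move=> [a i] /= /codomP[k ->]; case: pickP => [l /eqP->//|/(_ k)].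
  by rewrite eqxx.
apply: eq_big => [[k i]|[k i] _] //=; rewrite codom_f /=; apply/eqP.
case: pickP => [l /eqP/one_photon_inj->//|/(_ k)].
by rewrite eqxx.
Qed.

End OnePhoton.

(** * Matrix elements of the error operators between one-photon states *)

Section RestrictedEntries.
Variables (R : realType) (L : nat).
Local Notation C := R[i].
Implicit Types (i k : 'I_L) (j : nat).

Definition bket_r j i : R := (i == j :> nat)%:R.

(** Two distinct one-photon strings differ exactly at their photon positions, so both positions must
    lie in the pair. *)
Lemma agree_off_pair j k k' :
  [forall m : 'I_L, ((m != j :> nat) && (m != j.+1 :> nat)) ==>
     (tnth (one_photon _ k) m == tnth (one_photon _ k') m)]
  = (k == k') || ((k == j :> nat) || (k == j.+1 :> nat))
                 && ((k' == j :> nat) || (k' == j.+1 :> nat)).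
Proof.
have [->|kk'] := eqVneq k k'; first by apply/forallP => m; rewrite eqxx implybT.
apply/forallP/idP => /= [agree|/andP[kj kj'] m]; last first.
  rewrite !tnth_mktuple -negb_or; apply/implyP => mj.
  have /negbTE-> : m != k by apply: contra mj => /eqP->.
  by have /negbTE-> : m != k' by apply: contra mj => /eqP->.
have := agree k; have := agree k'; rewrite !tnth_mktuple !eqxx [k' == k]eq_sym.
by rewrite -!negb_or (negbTE kk') /= !implybF !negbK => -> ->.
Qed.

(** With [bit_once], this discards the impossible bit patterns in the case analyses of the matrix
    elements. *)
Lemma bit_pair_excl j k : (k == j :> nat) && (k == j.+1 :> nat) = false.
Proof. by case: eqP => //= ->; rewrite ltn_eqF. Qed.

Lemma bit_once j k k' : k != k' -> (k == j :> nat) && (k' == j :> nat) = false.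
Proof.
by apply: contra_neqF => /andP[/eqP kj /eqP k'j]; apply: val_inj; rewrite /= kj.
Qed.

Lemma proj_real (T : Type) (u : T -> C) (v : T -> R) x y :
  (forall z, u z = ((v z)%:C)%C) -> proj u x y = ((v x * v y)%:C)%C.
Proof. by move=> uv; rewrite /proj !uv conj_real rmorphM. Qed.

(** The [|11>] term of [e_ph_j] leaves no trace here, since a one-photon string has no two ones. *)
Definition e_ph_r j k i k' i' : R :=
  kappa R L j * (bket_r j.+1 k * bket_r j.+1 k') * (bket_r j i * bket_r j i')
  + kappa R L j.+1 * (bket_r j k * bket_r j k') * (bket_r j.+1 i * bket_r j.+1 i').

Lemma entry_e_ph_j j k i k' i' :
  entry R L (e_ph_j R L j) (one_photon _ k, i) (one_photon _ k', i')
  = ((e_ph_r j k i k' i')%:C)%C.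
Proof.
rewrite entryD entry_sum !big_bool /= !entry_mx_of /= agree_off_pair.
rewrite !big_bool /= !nth_one_photon !addn0 !addn1.
rewrite /proj /pair2 /qket /bket /= !rmorphM !rmorph_nat.
rewrite ![j == k]eq_sym ![j == k']eq_sym ![j.+1 == k]eq_sym ![j.+1 == k']eq_sym.
rewrite /e_ph_r /bket_r rmorphD !rmorphM !rmorph_nat.
have [<-|kk'] := eqVneq k k'.
  move: (bit_pair_excl j k).
  by case: (k == j :> nat) (k == j.+1 :> nat) => [] [] //= _; ring.
move: (bit_pair_excl j k) (bit_pair_excl j k') (bit_once j _ _ kk') (bit_once j.+1 _ _ kk').
by case: (k == j :> nat) (k == j.+1 :> nat) (k' == j :> nat) (k' == j.+1 :> nat)
  => [] [] [] [] //= _ _ _ _; ring.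
Qed.

Definition hket_r (s x : bool) : R := (if x then (-1) ^+ s else 1) / Num.sqrt 2.

Definition piket_r j (s : bool) i : R :=
  (Num.sqrt (kappa R L j) * bket_r j i
   + (-1) ^+ s * Num.sqrt (kappa R L j.+1) * bket_r j.+1 i) / Num.sqrt 2.

Lemma hketE s x : hket R s x = ((hket_r s x)%:C)%C.
Proof.
by rewrite /hket_r fmorph_div /hket; case: x; rewrite ?rmorphXn ?rmorphN rmorph1.
Qed.

Lemma piketE j s i : piket R j s i = ((piket_r j s i)%:C)%C.
Proof.
rewrite /piket_r fmorph_div rmorphD !rmorphM rmorphXn rmorphN rmorph1 !rmorph_nat.
by [].
Qed.

Lemma sqrt2V2 : (Num.sqrt 2 : R)^-1 ^+ 2 = 1 / 2.
Proof. by rewrite exprVn sqr_sqrtr ?ler0n // div1r. Qed.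

Lemma kappa_ge0 j : 0 <= kappa R L j.
Proof. by rewrite /kappa; case: ifP => _; lra. Qed.

(** Summing over [s] and [s'] is a Fourier sum over the flipped bits. If no bit flips, the signs of
    [piket] cancel and the mode-diagonal part survives; if both flip, only the mode-exchanging part
    survives, with a minus sign from the [true] in [s (+) s' (+) true]. A single flip cannot occur
    between one-photon strings. *)
Definition e_b_r j k i k' i' : R :=
  (k == k')%:R * (kappa R L j * (bket_r j i * bket_r j i')
                  + kappa R L j.+1 * (bket_r j.+1 i * bket_r j.+1 i')) / 2
  - Num.sqrt (kappa R L j) * Num.sqrt (kappa R L j.+1) / 2
    * (bket_r j k * bket_r j.+1 k' + bket_r j.+1 k * bket_r j k')
    * (bket_r j i * bket_r j.+1 i' + bket_r j.+1 i * bket_r j i').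

Lemma entry_e_b_j j k i k' i' :
  entry R L (e_b_j R L j) (one_photon _ k, i) (one_photon _ k', i')
  = ((e_b_r j k i k' i')%:C)%C.
Proof.
pose h s x y := hket_r s x * hket_r s y.
pose p s := piket_r j s i * piket_r j s i'.
have hE s x y : h s x y = (-1) ^+ (s && (x (+) y)) / 2.
  rewrite /h /hket_r; move: sqrt2V2; rewrite expr2 div1r => w2.
  by rewrite mulrACA w2; congr (_ / _); case: s x y => [] [] [] /=; ring.
have uE m : kappa R L m = Num.sqrt (kappa R L m) ^+ 2.
  by rewrite sqr_sqrtr ?kappa_ge0.
have pE s : p s = (kappa R L j * (bket_r j i * bket_r j i')
    + kappa R L j.+1 * (bket_r j.+1 i * bket_r j.+1 i')
    + (-1) ^+ s * (Num.sqrt (kappa R L j) * Num.sqrt (kappa R L j.+1))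
      * (bket_r j i * bket_r j.+1 i' + bket_r j.+1 i * bket_r j i')) / 2.
  rewrite /p /piket_r; move: sqrt2V2; rewrite expr2 div1r => w2.
  rewrite mulrACA w2; move: (uE j) (uE j.+1).
  set u := Num.sqrt (kappa R L j); set v := Num.sqrt (kappa R L j.+1) => -> ->.
  by case: s => /=; field.
rewrite entry_sum; under eq_bigr do rewrite entry_sum.
(* All factors are real, so the entry is brought under one embedding of [R]; what remains is a real
   identity checked on bit patterns. *)
transitivity (\sum_(s : bool) \sum_(s' : bool)
  (((k == k') || ((k == j :> nat) || (k == j.+1 :> nat))
                 && ((k' == j :> nat) || (k' == j.+1 :> nat)))%:R
   * (h s (k == j :> nat) (k' == j :> nat) * h s' (k == j.+1 :> nat) (k' == j.+1 :> nat))
   * p (s (+) s' (+) true))%:C : C)%C.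
  apply: eq_bigr => s _; apply: eq_bigr => s' _.
  rewrite entry_mx_of /= agree_off_pair !nth_one_photon.
  rewrite ![j == k]eq_sym ![j == k']eq_sym ![j.+1 == k]eq_sym ![j.+1 == k']eq_sym.
  rewrite (@proj_real _ _ (piket_r j (s (+) s' (+) true))); last exact: piketE.
  rewrite (@proj_real _ _ (fun q => hket_r s q.1 * hket_r s' q.2)); last first.
    by move=> q; rewrite /pair2 !hketE [RHS]rmorphM.
  rewrite -(rmorph_nat (real_complex R)) -!rmorphM.
  by congr (_ * _ * _)%:C%C; rewrite /= mulrACA.
rewrite !big_bool /= -!(rmorphD (real_complex R)); congr (_%:C)%C.
rewrite !hE !pE /= /e_b_r.
rewrite /bket_r.
have [<-|kk'] := eqVneq k k'.
  rewrite !addbb; move: (bit_pair_excl j k).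
  by case: (k == j :> nat) (k == j.+1 :> nat) => [] [] //= _; field.
move: (bit_pair_excl j k) (bit_pair_excl j k') (bit_once j _ _ kk') (bit_once j.+1 _ _ kk').
by case: (k == j :> nat) (k == j.+1 :> nat) (k' == j :> nat) (k' == j.+1 :> nat)
  => [] [] [] [] //= _ _ _ _; field.
Qed.

End RestrictedEntries.

(** * Sums over pairs of neighbouring modes *)

Section NeighbourSums.
Variables (R : realType) (n : nat).
Local Notation L := n.+1.

(** The modes j and j+1 of a pair, in the forms produced by [big_ord_recr] and [big_ord_recl]
    respectively. *)
Definition lo (j : 'I_n) : 'I_L := widen_ord (leqnSn n) j.
Definition hi (j : 'I_n) : 'I_L := lift ord0 j.

(** An inner mode lies in two pairs with weight 1/2, an end mode in one pair with weight 1, so each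
    mode is counted once. *)
Lemma sum_kappa (f : 'I_L -> R) : (0 < n)%N ->
  \sum_(j < n) (kappa R L j * f (lo j) + kappa R L j.+1 * f (hi j)) = \sum_i f i.
Proof.
move=> n_gt0; rewrite big_split /=.
have lastE : \sum_(i < L) kappa R L i * f i
    = \sum_(j < n) kappa R L j * f (lo j) + f ord_max.
  by rewrite big_ord_recr /= [kappa R L n]/kappa eqxx orbT mul1r.
have firstE : \sum_(i < L) kappa R L i * f i
    = f ord0 + \sum_(j < n) kappa R L j.+1 * f (hi j).
  by rewrite big_ord_recl /= [kappa R L 0]/kappa /= mul1r.
(* Pointwise, [2 * kappa i] is 1 plus the indicators of the two ends; [0 < n] keeps the ends
   distinct. *)
have doubleE : 2 * \sum_(i < L) kappa R L i * f i = \sum_i f i + (f ord0 + f ord_max).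
  have dirac a : f a = \sum_i (i == a)%:R * f i.
    by rewrite (bigD1 a) //= eqxx mul1r big1 ?addr0 // => i /negbTE->; rewrite mul0r.
  rewrite (dirac ord0) (dirac ord_max) -!big_split mulr_sumr /=.
  apply: eq_bigr => i _; rewrite /kappa -!val_eqE /=.
  by case: eqP => [->|_]; case: eqP => [e|_] /=; try lra; rewrite -e ltnn in n_gt0.
lra.
Qed.

Lemma sum_superdiag (d : 'I_L -> 'I_L -> R) :
  \sum_(j < n) d (lo j) (hi j) = \sum_(k < L) \sum_(i < L | i == k.+1 :> nat) d k i.
Proof.
rewrite big_ord_recr /= [X in _ + X]big1 ?addr0.
  by apply: eq_bigr => j _; rewrite (big_pred1 (hi j)) // => i; rewrite -val_eqE.
by move=> i /eqP iL; have := ltn_ord i; rewrite iL ltnn.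
Qed.

(** The diagonal, the superdiagonal and the subdiagonal are disjoint, so each nonnegative entry is
    counted at most once on the left. *)
Lemma sum_tridiag_le (d : 'I_L -> 'I_L -> R) : (forall k i, 0 <= d k i) ->
  \sum_i d i i + \sum_(j < n) (d (lo j) (hi j) + d (hi j) (lo j)) <= \sum_k \sum_i d k i.
Proof.
move=> d0; rewrite big_split /= sum_superdiag (sum_superdiag (fun k i => d i k)).
under [X in _ + (_ + X)]eq_bigr do rewrite big_mkcond.
rewrite [X in _ + (_ + X)]exchange_big -!big_split /=; apply: ler_sum => k _.
rewrite -[d k k](big_pred1_eq +%R k (d k)) big_mkcond [X in _ + (X + _)]big_mkcond.
rewrite -!big_split /=; apply: ler_sum => i _; have := d0 k i.
rewrite -val_eqE /=.
case: (ltngtP i k) => [ik|ki|->]; last by rewrite !ltn_eqF // addr0; lra.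
- by rewrite (ltn_eqF (leqW ik)); case: ifP; lra.
- by rewrite (ltn_eqF (leqW ki)); case: ifP; lra.
Qed.

End NeighbourSums.

(** * Traces on the one-photon sector and the inequality for a fixed l *)

Section Bound.
Variables (R : realType) (n : nat).
Local Notation L := n.+1.
Variable rho : op R L.
Hypothesis rho_density : density rho.
Hypothesis rho_one_photon : P1 R L *m rho *m P1 R L = rho.
Implicit Types x y : 'I_L * 'I_L.

(** Populations for [x = y], coherences otherwise. Real parts suffice because the restricted error
    operators have real entries. *)
Definition coh x y : R :=
  Re (entry R L rho (one_photon _ x.1, x.2) (one_photon _ y.1, y.2)).

Definition tr_r (m : 'I_L -> 'I_L -> 'I_L -> 'I_L -> R) : R :=
  \sum_x \sum_y coh x y * m y.1 y.2 x.1 x.2.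

(** The support of [rho] cuts both sums of the trace down to one-photon states, so other entries of
    [M] do not enter. *)
Lemma Re_trace (M : op R L) m :
  (forall k i k' i', entry R L M (one_photon _ k, i) (one_photon _ k', i')
                     = ((m k i k' i')%:C)%C) ->
  Re (\tr (rho *m M)) = tr_r m.
Proof.
move=> Mm; rewrite trace_entry.
under eq_bigr do rewrite entryM.
rewrite sum_one_photon => [|x x1]; last first.
  rewrite big1 // => y _.
  by rewrite (one_photon_support R L rho) ?mul0r // (negbTE x1).
rewrite pair_big Re_sum; apply: eq_bigr => x _.
rewrite sum_one_photon => [|y y1]; last first.
  by rewrite (one_photon_support R L rho) ?mul0r // (negbTE y1) andbF.
rewrite pair_big Re_sum; apply: eq_bigr => y _.
by rewrite Mm Re_mulr_real.
Qed.

Lemma coh_form x y (a b : R) :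
  0 <= a ^+ 2 * coh x x + 2 * a * b * coh x y + b ^+ 2 * coh y y.
Proof. exact: density_form. Qed.

Lemma coh_ge0 x : 0 <= coh x x.
Proof. by have := coh_form x x 1 0; lra. Qed.

Lemma cohC x y : coh x y = coh y x.
Proof.
have [herm _ _] := rho_density.
by rewrite /coh /entry -[in LHS]herm !mxE Re_conj.
Qed.

Lemma sum_coh_diag : \sum_k \sum_i coh (k, i) (k, i) = 1.
Proof.
have [_ _ tr1] := rho_density.
transitivity (Re (\tr rho)); last by rewrite tr1.
rewrite trace_entry sum_one_photon => [|x x1].
  by rewrite Re_sum; apply: eq_bigr => k _; rewrite Re_sum.
by rewrite (one_photon_support R L rho) // (negbTE x1).
Qed.

Lemma tr_rD m1 m2 :
  tr_r (fun k i k' i' => m1 k i k' i' + m2 k i k' i') = tr_r m1 + tr_r m2.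
Proof.
rewrite /tr_r -big_split; apply: eq_bigr => x _.
by rewrite -big_split; apply: eq_bigr => y _; rewrite mulrDr.
Qed.

Lemma tr_rZ a m : tr_r (fun k i k' i' => a * m k i k' i') = a * tr_r m.
Proof.
rewrite /tr_r mulr_sumr; apply: eq_bigr => x _.
by rewrite mulr_sumr; apply: eq_bigr => y _; rewrite mulrCA.
Qed.

Lemma eq_tr_r m1 m2 : (forall k i k' i', m1 k i k' i' = m2 k i k' i') ->
  tr_r m1 = tr_r m2.
Proof. by move=> m12; apply: eq_bigr => x _; apply: eq_bigr => y _; rewrite m12. Qed.

Lemma tr_r_sum (I : finType) (m : I -> 'I_L -> 'I_L -> 'I_L -> 'I_L -> R) :
  tr_r (fun k i k' i' => \sum_t m t k i k' i') = \sum_t tr_r (m t).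
Proof.
rewrite /tr_r [RHS]exchange_big; apply: eq_bigr => x _.
by rewrite [RHS]exchange_big; apply: eq_bigr => y _; rewrite mulr_sumr.
Qed.

Lemma sum_bket (a : 'I_L) (F : 'I_L -> R) : \sum_i F i * bket_r R L a i = F a.
Proof.
rewrite (bigD1 a) //= big1 /bket_r ?eqxx ?mulr1 ?addr0 // => i.
by rewrite -val_eqE => /negbTE->; rewrite mulr0.
Qed.

Lemma sum_pair_bket (a : 'I_L * 'I_L) (F : 'I_L * 'I_L -> R) :
  \sum_x F x * (bket_r R L a.1 x.1 * bket_r R L a.2 x.2) = F a.
Proof.
rewrite (bigD1 a) //= big1 /bket_r ?eqxx ?mulr1 ?addr0 // => x xa.
by rewrite -natrM mulnb !val_eqE -xpair_eqE -!surjective_pairing (negbTE xa) mulr0.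
Qed.

(** Matrix units: the traces of the error operators are read off by expanding their entries into
    these. *)
Lemma tr_r_unit (k i k' i' : 'I_L) :
  tr_r (fun l m l' m' => bket_r R L k l * bket_r R L i m
                         * (bket_r R L k' l' * bket_r R L i' m'))
  = coh (k', i') (k, i).
Proof.
rewrite -[RHS](sum_pair_bket (k', i') (fun x => coh x (k, i))).
apply: eq_bigr => x _.
rewrite -(sum_pair_bket (k, i) (coh x)) mulr_suml.
by apply: eq_bigr => y _; rewrite mulrA.
Qed.

(** The identity on the photon position is resolved into matrix units, one for each [k]. *)
Lemma tr_r_mode (i : 'I_L) :
  tr_r (fun l m l' m' => (l == l')%:R * (bket_r R L i m * bket_r R L i m'))
  = \sum_k coh (k, i) (k, i).
Proof.
transitivity (tr_r (fun l m l' m' => \sum_(k < L)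
   bket_r R L k l * bket_r R L i m * (bket_r R L k l' * bket_r R L i m'))).
  apply: eq_tr_r => l m l' m'; rewrite -[LHS](sum_bket l (fun k =>
    (k == l')%:R * (bket_r R L i m * bket_r R L i m'))).
  apply: eq_bigr => k _.
  have -> : bket_r R L l k = bket_r R L k l by rewrite /bket_r eq_sym.
  have -> : (k == l')%:R = bket_r R L k l' by rewrite /bket_r eq_sym -val_eqE.
  ring.
by rewrite tr_r_sum; apply: eq_bigr => k _; rewrite tr_r_unit.
Qed.

Lemma tr_r_e_ph (j : 'I_n) : tr_r (e_ph_r R L j)
  = kappa R L j * coh (hi _ j, lo _ j) (hi _ j, lo _ j)
    + kappa R L j.+1 * coh (lo _ j, hi _ j) (lo _ j, hi _ j).
Proof.
rewrite -!tr_r_unit -!tr_rZ -tr_rD; apply: eq_tr_r => k i k' i'.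
by rewrite /e_ph_r /=; ring.
Qed.

Lemma tr_r_e_b (j : 'I_n) : tr_r (e_b_r R L j)
  = 1 / 2 * (kappa R L j * (\sum_k coh (k, lo _ j) (k, lo _ j))
             + kappa R L j.+1 * (\sum_k coh (k, hi _ j) (k, hi _ j)))
    - Num.sqrt (kappa R L j) * Num.sqrt (kappa R L j.+1)
      * (coh (lo _ j, lo _ j) (hi _ j, hi _ j)
         + coh (lo _ j, hi _ j) (hi _ j, lo _ j)).
Proof.
set s := Num.sqrt _ * Num.sqrt _.
(* Symmetry of [coh] splits the two coherences into four, one for each matrix unit in the exchange
   term of [e_b_r]. *)
have -> : - (s * (coh (lo _ j, lo _ j) (hi _ j, hi _ j)
                  + coh (lo _ j, hi _ j) (hi _ j, lo _ j)))
    = - (s / 2) * (coh (lo _ j, lo _ j) (hi _ j, hi _ j)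
                   + coh (lo _ j, hi _ j) (hi _ j, lo _ j)
                   + coh (hi _ j, lo _ j) (lo _ j, hi _ j)
                   + coh (hi _ j, hi _ j) (lo _ j, lo _ j)).
  by rewrite [coh (hi _ j, lo _ j) _]cohC [coh (hi _ j, hi _ j) _]cohC; field.
rewrite -!tr_r_mode -!tr_r_unit -!tr_rD -!tr_rZ -!tr_rD -!tr_rZ -tr_rD.
by apply: eq_tr_r => k i k' i'; rewrite /e_b_r -/s /=; field.
Qed.

(** The positive semidefinite matrix with diagonal A, B and off-diagonal -h is paired with the block
    of [coh] on x, y. The test vectors (sqrt A, sqrt B) and (sqrt A, - sqrt B) cover both signs of
    the coherence. *)
Lemma coh_cross (x y : 'I_L * 'I_L) (A B h : R) :
  0 <= A -> 0 <= B -> h ^+ 2 <= A * B ->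
  2 * h * coh x y <= A * coh x x + B * coh y y.
Proof.
move=> A0 B0 hAB.
have := coh_form x y (Num.sqrt A) (Num.sqrt B).
have := coh_form x y (Num.sqrt A) (- Num.sqrt B).
have : `|h * coh x y| <= Num.sqrt A * Num.sqrt B * `|coh x y|.
  rewrite normrM ler_wpM2r // -sqrtrM // -sqrtr_sqr.
  by rewrite ler_wsqrtr.
rewrite sqrrN !sqr_sqrtr //.
have := ler_norm (h * coh x y); case: (ger0P (coh x y)) => _; nra.
Qed.

(** With at least three modes no pair joins the two ends, which rules out the weights 1, 1. *)
Lemma kappa_neighbours (j : 'I_n) : (1 < n)%N ->
  (kappa R L j = 1 /\ kappa R L j.+1 = 1 / 2)
  \/ (kappa R L j = 1 / 2 /\ (kappa R L j.+1 = 1 \/ kappa R L j.+1 = 1 / 2)).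
Proof.
move=> n_gt1; have jn := ltn_ord j; rewrite /kappa /= (ltn_eqF jn) orbF.
case: eqP => [->|_]; first by left; rewrite (ltn_eqF n_gt1).
by right; split=> //; case: eqP; [left | right].
Qed.

(* The top eigenvalue of e_ph - l e_b on the one-photon sector for
   0 < l <= 3 + sqrt 5. *)
Definition top_eig (l : R) : R := (3 - 2 * l + Num.sqrt (1 + 2 * l ^+ 2)) / 4.

Lemma neighbour_bound (j : 'I_n) (l : R) : (1 < n)%N -> 0 < l ->
  kappa R L j * coh (hi _ j, lo _ j) (hi _ j, lo _ j)
  + kappa R L j.+1 * coh (lo _ j, hi _ j) (lo _ j, hi _ j)
  + l * (Num.sqrt (kappa R L j) * Num.sqrt (kappa R L j.+1)
         * coh (lo _ j, hi _ j) (hi _ j, lo _ j))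
  <= (top_eig l + l / 2) * (coh (lo _ j, hi _ j) (lo _ j, hi _ j)
                        + coh (hi _ j, lo _ j) (hi _ j, lo _ j)).
Proof.
move=> n_gt1 l_gt0; rewrite /top_eig; set s := Num.sqrt (1 + _).
have s_ge0 : 0 <= s by exact: sqrtr_ge0.
have s2 : s ^+ 2 = 1 + 2 * l ^+ 2 by rewrite sqr_sqrtr //; nra.
(* [1 <= s] makes the shifted diagonal entries nonnegative; [l <= s] serves the inner blocks. *)
have s_ge1 : 1 <= s by nra.
have s_gel : l <= s by nra.
pose h := l * (Num.sqrt (kappa R L j) * Num.sqrt (kappa R L j.+1)) / 2.
have h2 : h ^+ 2 = l ^+ 2 * kappa R L j * kappa R L j.+1 / 4.
  by rewrite /h !exprMn !sqr_sqrtr ?kappa_ge0 //; field.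
(* Since [top_eig l + l / 2] is (3 + s) / 4, the claim is positivity of (3 + s) / 4 minus the block.
   The determinant condition is an equality on the boundary blocks, where (s^2 - 1) / 16 = l^2 / 8,
   and reads l^2 <= (s + 1)^2 on the inner ones. *)
have := coh_cross (lo _ j, hi _ j) (hi _ j, lo _ j)
  ((3 + s) / 4 - kappa R L j.+1) ((3 + s) / 4 - kappa R L j) h.
rewrite h2 /h; case: (kappa_neighbours j n_gt1) => [[-> ->]|[-> [->|->]]].
all: set c := Num.sqrt _ * Num.sqrt _ => /(_ ltac:(nra) ltac:(nra) ltac:(nra)); lra.
Qed.

Lemma e_ph_le_e_b (l : R) : (1 < n)%N -> 0 < l -> 0 <= top_eig l ->
  Re (\tr (rho *m e_ph R L)) <= l * Re (\tr (rho *m e_b R L)) + top_eig l.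
Proof.
move=> n_gt1 l_gt0 top_ge0.
have -> : Re (\tr (rho *m e_ph R L)) = \sum_(j < n) tr_r (e_ph_r R L j).
  rewrite -tr_r_sum; apply: Re_trace => k i k' i'; rewrite entry_sum rmorph_sum.
  by apply: eq_bigr => j _; rewrite entry_e_ph_j.
have -> : Re (\tr (rho *m e_b R L)) = \sum_(j < n) tr_r (e_b_r R L j).
  rewrite -tr_r_sum; apply: Re_trace => k i k' i'; rewrite entry_sum rmorph_sum.
  by apply: eq_bigr => j _; rewrite entry_e_b_j.
under eq_bigr do rewrite tr_r_e_ph.
set E := (X in X <= _).
under [X in _ <= _ * X + _]eq_bigr do rewrite tr_r_e_b [X in _ - X]mulrDr opprD.
rewrite big_split /= -mulr_sumr.
rewrite (sum_kappa _ _ (fun i => \sum_k coh (k, i) (k, i))) ?(ltnW n_gt1) //.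
rewrite exchange_big /= sum_coh_diag big_split /= !sumrN.
(* The trace with [e_b] is now 1/2 - S1 - S2, where [S1] carries the coherences of the diagonal
   chain and [S2] those of the 2 x 2 blocks. *)
set S1 := (X in - X - _); set S2 := (X in _ - X).
pose D := \sum_i coh (i, i) (i, i).
pose O := \sum_j (coh (lo _ j, hi _ j) (lo _ j, hi _ j)
                  + coh (hi _ j, lo _ j) (hi _ j, lo _ j)).
have D_ge0 : 0 <= D by apply: sumr_ge0 => i _; exact: coh_ge0.
have DO : D + O <= 1.
  rewrite -sum_coh_diag.
  by apply: (sum_tridiag_le _ _ (fun k i => coh (k, i) (k, i))) => k i; exact: coh_ge0.
(* Each link of the chain is bounded by the [kappa]-weighted populations of its ends, and these
   weights add up to [D]. *)
have S1D : 2 * S1 <= D.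
  rewrite /D -(sum_kappa _ _ (fun i => coh (i, i) (i, i))) ?(ltnW n_gt1) //.
  rewrite mulr_sumr; apply: ler_sum => j _; rewrite mulrA.
  by apply: coh_cross; rewrite ?kappa_ge0 // exprMn !sqr_sqrtr ?kappa_ge0.
have EO : E + l * S2 <= (top_eig l + l / 2) * O.
  rewrite mulr_sumr -big_split mulr_sumr; apply: ler_sum => j _.
  exact: neighbour_bound.
(* It remains to see (t + l/2) O + l S1 <= t + l/2 with t = [top_eig l]. As t >= 0, l S1 <= (l/2) D
   <= (t + l/2) D, and D + O <= 1 concludes. *)
nra.
Qed.

End Bound.

(** * The range of l with nonnegative top eigenvalue, and the theorem *)

Lemma sqrt5_bounds (R : realType) : 2 < Num.sqrt 5 :> R /\ Num.sqrt 5 < 3 :> R.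
Proof.
have := sqrtr_ge0 (5 : R); have : Num.sqrt 5 ^+ 2 = 5 :> R by rewrite sqr_sqrtr.
by split; nra.
Qed.

Lemma top_eig_ge0 (R : realType) (l : R) : 0 < l <= 3 + Num.sqrt 5 -> 0 <= top_eig R l.
Proof.
case/andP=> l_gt0 l_le; rewrite /top_eig.
have [lo5 hi5] := sqrt5_bounds R.
have s5 : Num.sqrt 5 ^+ 2 = 5 :> R by rewrite sqr_sqrtr.
have s2 : Num.sqrt (1 + 2 * l ^+ 2) ^+ 2 = 1 + 2 * l ^+ 2.
  by rewrite sqr_sqrtr //; nra.
have := sqrtr_ge0 (1 + 2 * l ^+ 2); set s := Num.sqrt (1 + _) in s2 * => s_ge0.
have [l_small|l_big] := lerP (2 * l) 3; first by lra.
suff : 2 * l - 3 <= s by lra.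
rewrite -(@ler_pXn2r _ 2) ?nnegrE //; last by lra.
(* Squaring turns the goal into l^2 - 6 l + 4 <= 0, whose roots are 3 - sqrt 5 and 3 + sqrt 5. *)
rewrite s2; have : 0 <= (3 + Num.sqrt 5 - l) * (l - (3 - Num.sqrt 5)).
  by apply: mulr_ge0; lra.
nra.
Qed.

Lemma top_eig_root (R : realType) : top_eig R (3 + Num.sqrt 5) = 0.
Proof.
have [lo5 hi5] := sqrt5_bounds R.
have s5 : Num.sqrt 5 ^+ 2 = 5 :> R by rewrite sqr_sqrtr.
(* Both sides equal 29 + 12 sqrt 5, so the inner root is 3 + 2 sqrt 5 = 2 l - 3. *)
rewrite /top_eig (_ : 1 + _ = (3 + 2 * Num.sqrt 5) ^+ 2); last by nra.
by rewrite sqrtr_sqr ger0_norm; lra.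
Qed.

Theorem theorem1 (R : realType) (L : nat) (rho : op R L) (eb1 eph1 : R) :
  (3 <= L)%N ->
  density rho ->
  P1 R L *m rho *m P1 R L = rho ->
  \tr (rho *m e_b R L) = (eb1%:C)%C ->
  \tr (rho *m e_ph R L) = (eph1%:C)%C ->
  (0 <= eb1 <= (10 - 3 * Num.sqrt 5) / 22 ->
     eph1 <= (3 + Num.sqrt 5) * eb1) /\
  ((10 - 3 * Num.sqrt 5) / 22 < eb1 ->
     eph1 <= inf [set y : R | exists2 l : R, 0 < l < 3 + Num.sqrt 5 &
                   y = l * eb1 + (3 - 2 * l + Num.sqrt (1 + 2 * l ^+ 2)) / 4]).
Proof.
case: L rho => // n rho n_gt1 dens supp ebE ephE.
have [lo5 hi5] := sqrt5_bounds R.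
have bound l : 0 < l <= 3 + Num.sqrt 5 -> eph1 <= l * eb1 + top_eig R l.
  move=> l_bnd; have /andP[l_gt0 _] := l_bnd.
  have := e_ph_le_e_b R n rho dens supp l n_gt1 l_gt0 (top_eig_ge0 R l l_bnd).
  by rewrite ebE ephE.
split=> _.
  (* At the right end point the additive term vanishes and the bound is purely linear. *)
  have := bound (3 + Num.sqrt 5); rewrite top_eig_root addr0; apply.
  by rewrite lexx andbT; lra.
apply: lb_le_inf.
  (* The set under the infimum must be inhabited; l = 1 is an admissible choice. *)
  by exists (1 * eb1 + top_eig R 1), 1 => //; apply/andP; split; lra.
move=> _ [l /andP[l_gt0 l_lt] ->]; apply: bound.
by rewrite l_gt0 ltW.
Qed.
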